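(* Let $X$ and $Y$ be real Banach spaces and $N$ an absolute normalized norm on $\mathbb{R}^2$. If $Z=X\oplus_N Y$ has the diametral strong diameter 2 property, then either $Z=X\oplus_1 Y$ or $Z=X\oplus_\infty Y$ (equality meaning that the norm of $Z$ on $X\times Y$ coincides with the norm of the respective sum).
   Context: For a Banach space $X$, $B_X$ is its closed unit ball. A Banach space $X$ has the diametral strong diameter 2 property if for every convex combination $C$ of (nonempty) relatively weakly open subsets of $B_X$ (i.e. $C=\sum_{i=1}^n\lambda_iU_i$ with $n\in\mathbb{N}$, $\lambda_i\ge0$, $\sum_{i=1}^n\lambda_i=1$, $U_i$ nonempty relatively weakly open in $B_X$), for every $x\in C$ and every $\varepsilon>0$ there is a $y\in C$ such that $\|x-y\|>1+\|x\|-\varepsilon$. A norm $N$ on $\mathbb{R}^2$ is absolute if $N(a,b)=N(|a|,|b|)$ for all $(a,b)\in\mathbb{R}^2$, and normalized if $N(1,0)=N(0,1)=1$. $X\oplus_N Y$ is $X\times Y$ with the norm $\|(x,y)\|_N=N(\|x\|,\|y\|)$; $X\oplus_1Y$ and $X\oplus_\infty Y$ are the cases where $N$ is the $\ell_1$-norm and the $\ell_\infty$-norm on $\mathbb{R}^2$, respectively. *)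

(* Defs.v *)
From HB Require Import structures.
From mathcomp Require Import all_boot all_order all_algebra.
From mathcomp Require Import all_classical all_reals all_analysis.
From mathcomp Require Import ring lra.
Import Order.TTheory GRing.Theory Num.Theory.
Import numFieldNormedType.Exports.

Set Implicit Arguments.
Unset Strict Implicit.
Unset Printing Implicit Defensive.

Local Open Scope classical_set_scope.
Local Open Scope ring_scope.

(* The coarsest topology on V making every norm-continuous linear functional
   continuous. *)
Definition weak (R : realType) (V : normedModType R) : topologicalType :=
  sup_topology
    (fun f : {f : {linear V -> R^o} | continuous (f : V -> R^o)} =>
       Topological.class (initial_topology (sval f : V -> R^o))).

Definition unit_ball (R : realType) (V : normedModType R) : set V :=
  [set x | `|x| <= 1].
Arguments unit_ball {R} V.

Definition rel_weakly_open (R : realType) (V : normedModType R)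
    (U : set V) : Prop :=
  exists2 W : set (weak V), open W & U = unit_ball V `&` W.

Definition convex_comb (R : realType) (V : normedModType R) (n : nat)
    (lam : 'I_n -> R) (U : 'I_n -> set V) : set V :=
  [set \sum_(i < n) lam i *: u i | u in [set u : 'I_n -> V | forall i, U i (u i)]].

(* There is no need to ask n > 0: it follows from the lam i having sum 1. *)
Definition diametral_strong_diameter2 (R : realType) (V : normedModType R) :
    Prop :=
  forall (n : nat) (lam : 'I_n -> R) (U : 'I_n -> set V),
    (forall i, 0 <= lam i) -> \sum_(i < n) lam i = 1 ->
    (forall i, U i !=set0) -> (forall i, rel_weakly_open (U i)) ->
  forall x, convex_comb lam U x ->
  forall eps : R, 0 < eps ->
  exists2 y, convex_comb lam U y & `|x - y| > 1 + `|x| - eps.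

Record absNormalizedNorm (R : realType) := AbsNormalizedNorm {
  abs_norm :> R * R -> R ;
  abs_norm_triangle : forall p q, abs_norm (p + q) <= abs_norm p + abs_norm q ;
  abs_norm_scale : forall c a b,
    abs_norm (c * a, c * b) = `|c| * abs_norm (a, b) ;
  abs_norm_eq0 : forall p, abs_norm p = 0 -> p = 0 ;
  abs_norm_absolute : forall a b, abs_norm (a, b) = abs_norm (`|a|, `|b|) ;
  abs_norm10 : abs_norm (1, 0) = 1 ;
  abs_norm01 : abs_norm (0, 1) = 1
}.

Section abs_norm_theory.
Variables (R : realType) (N : absNormalizedNorm R).

Lemma abs_norm_x0 a : N (a, 0) = `|a|.
Proof.
by have := abs_norm_scale N a 1 0; rewrite mulr1 mulr0 abs_norm10 mulr1.
Qed.

Lemma abs_norm_0x b : N (0, b) = `|b|.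
Proof.
by have := abs_norm_scale N b 0 1; rewrite mulr1 mulr0 abs_norm01 mulr1.
Qed.

Lemma abs_norm_le_l a b c : 0 <= a -> a <= b -> N (a, c) <= N (b, c).
Proof.
move=> a0 ab; have [b0|b0] := eqVneq b 0.
  by have -> : a = b by apply: le_anti; rewrite ab b0 a0.
have bp : 0 < b by rewrite lt_neqAle eq_sym b0 (le_trans a0).
pose t := (1 + a / b) / 2; pose s := (1 - a / b) / 2.
have ab0 : 0 <= a / b by rewrite divr_ge0// ltW.
have ab1 : a / b <= 1 by rewrite ler_pdivrMr// mul1r.
have t0 : 0 <= t by rewrite /t; lra.
have s0 : 0 <= s by rewrite /s; lra.
have E : (a, c) = (t * b, t * c) + (s * (- b), s * c) :> R * R.
  by congr pair; rewrite /= /t /s; field.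
rewrite E (le_trans (abs_norm_triangle _ _ _))// !abs_norm_scale.
have -> : N (- b, c) = N (b, c) by rewrite abs_norm_absolute normrN -abs_norm_absolute.
rewrite !ger0_norm// -mulrDl.
have -> : t + s = 1 by rewrite /t /s; field.
by rewrite mul1r.
Qed.

End abs_norm_theory.

Definition abs_norm_swap_fun (R : realType) (N : absNormalizedNorm R)
  (p : R * R) := N (p.2, p.1).

Program Definition abs_norm_swap (R : realType) (N : absNormalizedNorm R) :=
  @AbsNormalizedNorm R (abs_norm_swap_fun N) _ _ _ _ _ _.
Next Obligation.
by move=> R N [a b] [c d]; exact: (abs_norm_triangle N (b, a) (d, c)).
Qed.
Next Obligation. by move=> R N c a b; exact: abs_norm_scale. Qed.
Next Obligation. by move=> R N [a b] /abs_norm_eq0[-> ->]. Qed.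
Next Obligation. by move=> R N a b; exact: abs_norm_absolute. Qed.
Next Obligation. by move=> R N; exact: abs_norm01. Qed.
Next Obligation. by move=> R N; exact: abs_norm10. Qed.

Section abs_norm_theory2.
Variables (R : realType) (N : absNormalizedNorm R).

Lemma abs_norm_le_r a b c : 0 <= a -> a <= b -> N (c, a) <= N (c, b).
Proof. exact: (abs_norm_le_l (abs_norm_swap N)). Qed.

Lemma abs_norm_le a b c d : 0 <= a -> a <= b -> 0 <= c -> c <= d ->
  N (a, c) <= N (b, d).
Proof.
move=> a0 ab c0 cd.
by rewrite (le_trans (abs_norm_le_l _ _ a0 ab))// abs_norm_le_r.
Qed.

End abs_norm_theory2.

Program Definition l1_norm (R : realType) : absNormalizedNorm R :=
  @AbsNormalizedNorm R (fun p => `|p.1| + `|p.2|) _ _ _ _ _ _.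
Next Obligation.
move=> R [a b] [c d] /=.
by rewrite (le_trans (lerD (ler_normD _ _) (ler_normD _ _)))// addrACA.
Qed.
Next Obligation. by move=> R c a b /=; rewrite !normrM mulrDr. Qed.
Next Obligation.
move=> R [a b] /= /eqP; rewrite paddr_eq0 ?normr_ge0// !normr_eq0.
by move=> /andP[/eqP-> /eqP->].
Qed.
Next Obligation. by move=> R a b /=; rewrite !normr_id. Qed.
Next Obligation. by move=> R /=; rewrite normr1 normr0 addr0. Qed.
Next Obligation. by move=> R /=; rewrite normr1 normr0 add0r. Qed.

Program Definition linfty_norm (R : realType) : absNormalizedNorm R :=
  @AbsNormalizedNorm R (fun p => Num.max `|p.1| `|p.2|) _ _ _ _ _ _.
Next Obligation.
move=> R [a b] [c d] /=; rewrite ge_max; apply/andP; split.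
  by rewrite (le_trans (ler_normD _ _))// lerD// le_max lexx.
by rewrite (le_trans (ler_normD _ _))// lerD// le_max lexx orbT.
Qed.
Next Obligation. by move=> R c a b /=; rewrite !normrM maxr_pMr. Qed.
Next Obligation.
move=> R [a b] /= m0.
have : `|a| <= 0 by rewrite -m0 le_max lexx.
have : `|b| <= 0 by rewrite -m0 le_max lexx orbT.
by rewrite !normr_le0 => /eqP-> /eqP->.
Qed.
Next Obligation. by move=> R a b /=; rewrite !normr_id. Qed.
Next Obligation. by move=> R /=; rewrite normr1 normr0 max_l. Qed.
Next Obligation. by move=> R /=; rewrite normr1 normr0 max_r. Qed.

(* X \oplus_N Y: an alias of X * Y, so that its norm is not the max norm that
   the library puts on products. *)
Definition abs_sum (R : realType) (N : absNormalizedNorm R)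
  (X Y : normedModType R) : Type := (X * Y)%type.

Definition abs_pair (R : realType) (N : absNormalizedNorm R)
  (X Y : normedModType R) (x : X) (y : Y) : abs_sum N X Y := (x, y).

Section abs_sum_normed.
Variables (R : realType) (N : absNormalizedNorm R) (X Y : normedModType R).
Local Notation Z := (abs_sum N X Y).

HB.instance Definition _ := GRing.Lmodule.copy Z (X * Y)%type.

Definition abs_sum_norm (z : Z) : R := N (`|z.1|, `|z.2|).

Let triangle (z w : Z) :
  abs_sum_norm (z + w) <= abs_sum_norm z + abs_sum_norm w.
Proof.
rewrite /abs_sum_norm (le_trans _ (abs_norm_triangle _ _ _))//.
by apply: abs_norm_le => //; exact: ler_normD.
Qed.

Let scale (c : R) (z : Z) : abs_sum_norm (c *: z) = `|c| * abs_sum_norm z.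
Proof. by rewrite /abs_sum_norm !normrZ abs_norm_scale normr_id. Qed.

Let definite (z : Z) : abs_sum_norm z = 0 -> z = 0.
Proof.
case: z => x y /abs_norm_eq0[/eqP + /eqP].
by rewrite !normr_eq0 => /eqP-> /eqP->.
Qed.

HB.instance Definition _ :=
  @Lmodule_isNormed.Build R Z abs_sum_norm triangle scale definite.

Lemma abs_sum_normE (x : X) (y : Y) :
  `|abs_pair N x y| = N (`|x|, `|y|).
Proof. by []. Qed.

Lemma abs_sum_norm_ge1 (z : Z) : `|z.1| <= `|z|.
Proof. by rewrite -[leLHS]normr_id -(abs_norm_x0 N) abs_norm_le. Qed.

Lemma abs_sum_norm_ge2 (z : Z) : `|z.2| <= `|z|.
Proof. by rewrite -[leLHS]normr_id -(abs_norm_0x N) abs_norm_le. Qed.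

Lemma abs_sum_norm_le (z : Z) : `|z| <= `|z.1| + `|z.2|.
Proof.
have := abs_norm_triangle N (`|z.1|, 0) (0, `|z.2|).
rewrite abs_norm_x0 abs_norm_0x !normr_id; apply: le_trans.
have -> // : (`|z.1|, 0) + (0, `|z.2|) = (`|z.1|, `|z.2|) :> R * R.
by congr pair; rewrite /= ?addr0 ?add0r.
Qed.

End abs_sum_normed.

Section abs_sum_complete.
Variables (R : realType) (N : absNormalizedNorm R).
Variables (X Y : completeNormedModType R).
Local Notation Z := (abs_sum N X Y).

Let abs_sum_cauchy_cvg (F : set_system Z) : ProperFilter F -> cauchy F -> cvg F.
Proof.
move=> FF Fc.
have proj (V : completeNormedModType R) (g : Z -> V) :
    (forall z w, `|g z - g w| <= `|z - w|) -> cvg (g @ F).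
  move=> gle; apply: cauchy_cvg; apply: cauchy_exP => e e0.
  have [z Fz] := iffLR (@cauchyP R Z F FF) Fc e e0.
  exists (g z); rewrite /fmap /=; near=> w.
  rewrite -ball_normE /= (le_lt_trans (gle _ _))//.
  have : ball z e w by near: w.
  by rewrite -ball_normE.
have /cvg_ex[/= x Fx] : cvg ((fst : Z -> X) @ F).
  by apply: proj => z w; exact: (abs_sum_norm_ge1 (z - w)).
have /cvg_ex[/= y Fy] : cvg ((snd : Z -> Y) @ F).
  by apply: proj => z w; exact: (abs_sum_norm_ge2 (z - w)).
apply/cvg_ex; exists ((x, y) : Z); apply/cvgrPdist_lt => e e0.
have e2 : 0 < e / 2 by rewrite divr_gt0.
move/cvgrPdist_lt/(_ _ e2) : Fx => Fx; move/cvgrPdist_lt/(_ _ e2) : Fy => Fy.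
near=> w; rewrite (le_lt_trans (abs_sum_norm_le _))// [ltRHS]splitr ltrD//.
  by near: w.
by near: w.
Unshelve. all: by end_near. Qed.

HB.instance Definition _ := Uniform_isComplete.Build Z abs_sum_cauchy_cvg.

End abs_sum_complete.

(* Main.v *)
Require Import Defs.
From HB Require Import structures.
From mathcomp Require Import all_boot all_order all_algebra.
From mathcomp Require Import all_classical all_reals all_analysis.
From mathcomp Require Import ring lra.
Import Order.TTheory GRing.Theory Num.Theory.
Import numFieldNormedType.Exports.
Local Open Scope classical_set_scope.
Local Open Scope ring_scope.

(** The diametral strong diameter 2 property of a normed space [V] forces a
Daugavet-type behaviour: given a unit vector [z], every slice [S] of the unit
ball [B] contains points at distance almost 2 from [z].  Indeed [S] contains
some [s] of norm less than 1, so that for a small [t > 0] the vector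
[w = 2 t z - s] still lies in [B], and [t z = (s + w) / 2] belongs to the convex
combination [C = (S + B) / 2].  A point [(a + b) / 2] of [C] almost diametral to
[t z] is at distance almost [1 + t] from it; as [b] is at distance at most
[1 + t] from [t z], averaging forces [a] to be at distance almost [1 + t] from
[t z] too, and by convexity of the norm [a] is then at distance almost 2 from
[z] itself ([dsd2_far_in_slice]).

For [Z] the absolute sum of two nonzero spaces [X] and [Y], take [z = (0, y)]
with [y] of norm 1 and the slice given by a norming functional of a unit vector
of [X].  The point of the slice far from [z] yields, up to an arbitrarily small
error, a number [q] in [[0, 1]] with [N (1, q) = 1] and [N (1, 1 + q) = 2]; this
is [dsd2_abs_norm_l].  Symmetrically there is a [p] in [[0, 1]] with
[N (p, 1) = 1] and [N (1 + p, 1) = 2].  Put [K = N (1, 1)], which lies in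
[[1, 2]].  The triangle inequality gives [2 <= K + q] and [2 <= K + p], while
adding [(p, 1)] and [(1, q)] gives [N (1 + p, 1 + q) <= 2].  Monotonicity of [N]
then yields [(3 - K) K <= 2], that is [(K - 1) (K - 2) >= 0]: so [K] is 1 or 2
([abs_norm11_dichotomy]).  On the positive quadrant, [K = 1] forces [N] to be
the maximum and [K = 2] forces it to be the sum.  If [X] or [Y] is zero, all
absolute normalized norms give the same norm on the sum.

The norming functionals come from the Hahn-Banach theorem, proved here in the
form: a sublinear functional [p] dominates a linear one that agrees with it at
a prescribed vector.  Instead of extending linear functionals from subspaces,
the proof shows that a minimal sublinear functional is linear. *)

(** * Sublinear functionals and the Hahn-Banach theorem *)

Definition sublinear {R : realType} {V : lmodType R} (q : V -> R) : Prop :=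
  (forall x y, q (x + y) <= q x + q y) /\
  (forall (t : R) x, 0 <= t -> q (t *: x) <= t * q x).

Lemma sublinear0_le {R : realType} {V : lmodType R} (q : V -> R) :
  sublinear q -> q 0 <= 0.
Proof. by case=> _ /(_ 0 0 (lexx _)); rewrite scale0r mul0r. Qed.

Lemma sublinearZ {R : realType} {V : lmodType R} (q : V -> R) (t : R) x :
  sublinear q -> 0 <= t -> q (t *: x) = t * q x.
Proof.
move=> sq; rewrite le_eqVlt => /predU1P[<-|t0].
  rewrite scale0r mul0r; apply/le_anti; rewrite sublinear0_le//=.
  by have := proj1 sq 0 0; rewrite addr0; lra.
apply/le_anti/andP; split; first by apply: (proj2 sq); exact: ltW.
rewrite -ler_pdivlMl//.
have -> : q x = q (t^-1 *: (t *: x)).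
  by rewrite scalerA mulVf ?scale1r ?gt_eqF.
by apply: (proj2 sq); rewrite invr_ge0 ltW.
Qed.

Lemma sublinear_oppr {R : realType} {V : lmodType R} (q : V -> R) x :
  sublinear q -> - q (- x) <= q x.
Proof.
move=> [qD _]; have := qD 0 0; have := qD x (- x).
by rewrite subrr addr0; lra.
Qed.

(** A pointwise infimum of functionals is sublinear as soon as the two sublinearity
inequalities can be realized by passing to another member of the family.  This covers both the chains of
Zorn's lemma and the directional regularization below. *)
Section pointwise_infimum.
Context {R : realType} {V : lmodType R} {I : Type}.
Variables (G : I -> V -> R) (i0 : I).
Hypothesis G_bounded : forall x, exists m, forall i, m <= G i x.

Let inf_G x := inf [set G i x | i in [set: I]].

Lemma inf_G_le i x : inf_G x <= G i x.
Proof.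
apply: ge_inf; last by exists i.
by have [m Gm] := G_bounded x; exists m => _ [j _ <-].
Qed.

Lemma le_inf_G m x : (forall i, m <= G i x) -> m <= inf_G x.
Proof.
move=> mG; apply: lb_le_inf; first by exists (G i0 x), i0.
by move=> _ [j _ <-].
Qed.

Lemma sublinear_inf :
  (forall i j x y, exists k, G k (x + y) <= G i x + G j y) ->
  (forall i (t : R) x, 0 <= t -> exists k, G k (t *: x) <= t * G i x) ->
  exists2 r : V -> R, sublinear r & forall i x, r x <= G i x.
Proof.
move=> GD GZ; exists inf_G; last exact: inf_G_le.
split=> [x y|t x].
  rewrite -lerBlDr; apply: le_inf_G => i.
  rewrite lerBlDr -lerBlDl; apply: le_inf_G => j.
  rewrite lerBlDl; have [k] := GD i j x y.
  exact/le_trans/inf_G_le.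
rewrite le_eqVlt => /predU1P[<-|t0].
  rewrite mul0r; have [k] := GZ i0 0 x (lexx _); rewrite mul0r.
  exact/le_trans/inf_G_le.
rewrite -ler_pdivrMl//; apply: le_inf_G => i.
rewrite ler_pdivrMl//; have [k] := GZ i t x (ltW t0).
exact/le_trans/inf_G_le.
Qed.

End pointwise_infimum.

(** Zorn's lemma: the infimum of a chain below [p] is finite because a sublinear
[q] below [p] satisfies [- p (- x) <= - q (- x) <= q x]. *)
Lemma exists_minimal_sublinear {R : realType} {V : lmodType R} (p : V -> R) :
  sublinear p ->
  exists2 q : V -> R, sublinear q /\ (forall x, q x <= p x) &
    forall r : V -> R, sublinear r -> (forall x, r x <= q x) ->
      forall x, q x <= r x.
Proof.
move=> sp.
pose T := {q : V -> R | sublinear q /\ forall x, q x <= p x}.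
pose below (a b : T) := `[< forall x, sval b x <= sval a x >].
pose p' : T := exist _ p (conj sp (fun x => lexx (p x))).
have [] := @ZL_preorder T p' below.
- by move=> a; apply/asboolP => x.
- move=> b a c /asboolP ab /asboolP bc; apply/asboolP => x.
  exact: le_trans (bc x) (ab x).
- move=> A chainA; have [[a0 Aa0]|A0] := pselect (A !=set0); last first.
    by exists p' => a Aa; case: A0; exists a.
  pose G (i : {a : T | A a}) := sval (sval i).
  have sG i : sublinear (G i) by have [] := svalP (sval i).
  have Gp i x : G i x <= p x by have [_] := svalP (sval i); exact.
  have [| | |r sr rG] := sublinear_inf G (exist _ a0 Aa0).
  + move=> x; exists (- p (- x)) => i.
    by apply: le_trans (sublinear_oppr _ _ (sG i)); rewrite lerN2.
  + (* in a chain the smaller of two functionals serves as the third *)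
    move=> i j x y.
    have [/asboolP ij|/asboolP ji] := chainA _ _ (svalP i) (svalP j).
    * exists j; apply: le_trans (proj1 (sG j) x y) _.
      by rewrite lerD2r; exact: ij.
    * exists i; apply: le_trans (proj1 (sG i) x y) _.
      by rewrite lerD2l; exact: ji.
  + by move=> i t x t0; exists i; exact: (proj2 (sG i)).
  have rp x : r x <= p x.
    exact: le_trans (rG (exist _ a0 Aa0) x) (Gp _ _).
  exists (exist _ r (conj sr rp)) => a Aa; apply/asboolP => x.
  exact: (rG (exist _ a Aa)).
- move=> [q [sq qp]] qmax; exists q => // r sr rq x.
  have rp z : r z <= p z by exact: le_trans (rq z) (qp z).
  by have /asboolP := qmax (exist _ r (conj sr rp)) (asboolT rq); exact.
Qed.

(** The functional is [r x = inf_(t >= 0) (q (x + t y) - t q y)], the classical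
regularization of [q] in the direction [y]; the two bounds are the cases
[t = 0] and [t = 1]. *)
Lemma sublinear_shift {R : realType} {V : lmodType R} (q : V -> R) (y : V) :
  sublinear q ->
  exists2 r : V -> R, sublinear r &
    (forall x, r x <= q x) /\ (forall x, r x <= q (x + y) - q y).
Proof.
move=> sq; have [qD qZ] := sq.
pose G (t : {t : R | 0 <= t}) x := q (x + sval t *: y) - sval t * q y.
have [| | |r sr rG] := sublinear_inf G (exist _ 0 (lexx 0)).
- move=> x; exists (- q (- x)) => -[t t0]; rewrite /G /=.
  have := qD (x + t *: y) (- x).
  by rewrite addrAC subrr add0r (sublinearZ _ _ _ sq t0); lra.
- move=> [s s0] [t t0] x z; exists (exist _ (s + t) (addr_ge0 s0 t0)).
  rewrite /G /= scalerDl addrACA mulrDl.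
  by have := qD (x + s *: y) (z + t *: y); lra.
- move=> [s s0] t x t0; exists (exist _ (t * s) (mulr_ge0 t0 s0)).
  rewrite /G /= -scalerA -scalerDr.
  by have := qZ t (x + s *: y) t0; lra.
exists r => //; split=> x.
  by have := rG (exist _ 0 (lexx 0)) x; rewrite /G /= scale0r addr0 mul0r subr0.
by have := rG (exist _ 1 ler01) x; rewrite /G /= scale1r mul1r.
Qed.

(** A minimal sublinear [q] equals all its regularizations, so that
[q x + q y <= q (x + y)] and [q] is additive, hence linear.  Starting from the
regularization [p'] of [p] along [e] takes care of the value at [e]: below
[p'], a linear [f] satisfies [- f e = f (- e) <= p' (- e) <= - p e]. *)
Lemma hahn_banach {R : realType} {V : lmodType R} (p : V -> R) (e : V) :
  sublinear p ->
  exists f : {linear V -> R^o}, (forall x, f x <= p x) /\ f e = p e.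
Proof.
move=> sp; have [p' sp' [p'p p'e]] := sublinear_shift p e sp.
have [q [sq qp'] qmin] := exists_minimal_sublinear p' sp'.
have qD : {morph q : x y / x + y}.
  move=> x y; apply/le_anti/andP; split; first exact: (proj1 sq).
  have [r sr [rq rqy]] := sublinear_shift q y sq.
  by rewrite -lerBrDr (le_trans _ (rqy x))// qmin.
have q0 : q 0 = 0 by have := qD 0 0; rewrite addr0; lra.
have qN x : q (- x) = - q x by have := qD x (- x); rewrite subrr q0; lra.
have qZ t x : q (t *: x) = t * q x.
  have [t0|t0] := leP 0 t; first exact: sublinearZ.
  by rewrite -[t]opprK scaleNr qN sublinearZ ?mulNr// oppr_ge0 ltW.
have qlin : linear (q : V -> R^o) by move=> t x y; rewrite qD qZ.
pose f : {linear V -> R^o} :=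
  HB.pack (q : V -> R^o) (GRing.isLinear.Build R V R^o *:%R q qlin).
have fp x : f x <= p x by exact: le_trans (qp' x) (p'p x).
exists f; split => //; apply/le_anti; rewrite fp /=.
have := le_trans (qp' (- e)) (p'e (- e)); rewrite addNr qN.
by have := sublinear0_le _ sp; rewrite /f/=; lra.
Qed.

(** * Slices of the unit ball *)

Lemma le_norm_continuous {R : realType} {V : normedModType R}
    (f : {linear V -> R^o}) :
  (forall x, f x <= `|x|) -> continuous (f : V -> R^o).
Proof.
move=> fle x; apply/cvgrPdist_lt => e e0; near=> y.
rewrite -linearB (@le_lt_trans _ _ `|x - y|)//.
  rewrite ler_norml fle andbT lerNl -linearN (le_trans (fle _))//.
  by rewrite normrN.
Unshelve. all: by end_near. Qed.

(** The weak topology is a supremum of initial topologies, hence finer than the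
one that [f] induces. *)
Lemma weak_continuous {R : realType} {V : normedModType R}
    (f : {linear V -> R^o}) :
  continuous (f : V -> R^o) -> continuous (f : weak V -> R^o).
Proof.
move=> fc x; have /cvg_sup/(_ (exist _ f fc)) xf : nbhs (x : weak V) --> x by [].
apply: cvg_trans (@initial_continuous V R^o f x).
exact: cvg_app.
Qed.

Lemma rel_weakly_open_slice {R : realType} {V : normedModType R}
    (f : {linear V -> R^o}) (c : R) :
  continuous (f : V -> R^o) ->
  rel_weakly_open (unit_ball V `&` [set x | c < f x]).
Proof.
move=> fc; exists [set x : weak V | c < f x] => //.
have /continuousP fo := weak_continuous f fc.
by have := fo [set y | c < y]; apply; exact: open_gt.
Qed.

Lemma rel_weakly_open_ball {R : realType} {V : normedModType R} :
  rel_weakly_open (unit_ball V).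
Proof. by exists setT; [exact: openT|rewrite setIT]. Qed.

(** * The diametral strong diameter 2 property and the Daugavet property *)

(** The slice and the whole ball are averaged: [s] and [w] below are the points of
the slice and of the ball with mean [t z], and diametrality of a point of the
average passes to its component in the slice. *)
Lemma dsd2_far_in_slice {R : realType} {V : normedModType R}
    (f : {linear V -> R^o}) (e z : V) (delta : R) :
  diametral_strong_diameter2 V ->
  (forall x, f x <= `|x|) -> `|e| = 1 -> f e = 1 -> `|z| = 1 -> 0 < delta ->
  exists2 u, `|u| <= 1 /\ 1 - delta < f u & 2 - delta < `|u - z|.
Proof.
move=> dsd fle e1 fe1 z1 delta0.
(* capping at 1 makes [1 - d / 2] the norm of [s] *)
pose d := Num.min delta 1.
have [d0 d1 dd] : [/\ 0 < d, d <= 1 & d <= delta].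
  by rewrite /d lt_min !ge_min delta0 ltr01 !lexx orbT.
pose S : set V := unit_ball V `&` [set x | 1 - d < f x].
pose U (i : 'I_2) : set V := if i == ord0 then S else unit_ball V.
pose s : V := (1 - d / 2) *: e.
(* the largest [t] for which [2 t + `|s| <= 1], so that [w] is in the ball *)
pose t : R := d / 4.
have t0 : 0 < t by rewrite /t; lra.
pose w : V := (2 * t) *: z - s.
have sn : `|s| = 1 - d / 2 by rewrite normrZ e1 mulr1 ger0_norm//; lra.
have Ss : S s.
  split; first by rewrite /unit_ball /= sn; lra.
  by rewrite /= linearZ/= fe1 /GRing.scale /=; lra.
have Bw : unit_ball V w.
  rewrite /unit_ball /= (le_trans (ler_normB _ _))// normrZ z1 mulr1 sn.
  by rewrite ger0_norm /t; lra.
have [| | | | | |y [u Uu <-] yfar] :=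
    dsd 2%N (fun=> 2^-1) U _ _ _ _ (t *: z) _ (t * d / 2).
- by move=> _; lra.
- by rewrite big_ord_recl big_ord1; lra.
- move=> i; rewrite /U; case: ifP => _; [by exists s|].
  by exists w.
- move=> i; rewrite /U; case: ifP => _; last exact: rel_weakly_open_ball.
  exact/rel_weakly_open_slice/le_norm_continuous.
- exists (fun i => if i == ord0 then s else w).
    by move=> i; rewrite /U; case: ifP.
  rewrite big_ord_recl big_ord1 /= -scalerDr /w addrC subrK scalerA.
  by congr (_ *: _); field.
- by rewrite !mulr_gt0// invr_gt0.
have [u0 u1] := (Uu ord0, Uu (lift ord0 ord0)).
rewrite /U /= in u0 u1.
move: yfar; rewrite big_ord_recl big_ord1.
set a := u ord0 in u0 *; set b := u _ in u1 *.
rewrite normrZ z1 mulr1 (gtr0_norm t0) => far.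
have an : `|a| <= 1 by case: u0.
have far' : 1 + t - t * d < `|t *: z - a|.
  have tb : `|t *: z - b| <= t + 1.
    by rewrite (le_trans (ler_normB _ _))// normrZ z1 mulr1 gtr0_norm// lerD2l.
  have : `|t *: z - (2^-1 *: a + 2^-1 *: b)| <=
      2^-1 * `|t *: z - a| + 2^-1 * `|t *: z - b|.
    have half : `|2^-1 : R| = 2^-1 by rewrite ger0_norm//; lra.
    have -> : t *: z - (2^-1 *: a + 2^-1 *: b) =
        2^-1 *: (t *: z - a) + 2^-1 *: (t *: z - b).
      rewrite !scalerBr addrACA -opprD -scalerDl.
      by rewrite (_ : 2^-1 + 2^-1 = 1) ?scale1r//; field.
    by rewrite (le_trans (ler_normD _ _))// !normrZ half.
  by lra.
have conv : `|t *: z - a| <= t * `|a - z| + (1 - t).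
  rewrite distrC.
  have <- : t *: (a - z) + (1 - t) *: a = a - t *: z.
    by rewrite scalerBr scalerBl scale1r addrC addrA subrK.
  rewrite (le_trans (ler_normD _ _))// (normrZ t) (normrZ (1 - t)) (gtr0_norm t0).
  rewrite lerD2l ger0_norm; last by rewrite /t; lra.
  by rewrite ler_piMr//; rewrite /t; lra.
exists a; first by split => //; case: u0 => _ /=; lra.
apply: le_lt_trans (_ : 2 - d < _); first by lra.
by rewrite -(ltr_pM2l t0); lra.
Qed.

(** Hahn-Banach turns the condition that [p] be close to 1 into one about a
functional.  For [p] the norm of one component of a sum, this avoids a norming
functional on that component. *)
Lemma dsd2_far_in_face {R : realType} {V : normedModType R} (p : V -> R)
    (e z : V) (delta : R) :
  diametral_strong_diameter2 V -> sublinear p -> (forall x, p x <= `|x|) ->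
  `|e| = 1 -> p e = 1 -> `|z| = 1 -> 0 < delta ->
  exists2 u, `|u| <= 1 /\ 1 - delta < p u & 2 - delta < `|u - z|.
Proof.
move=> dsd sp ple e1 pe1 z1 delta0; have [f [fp fe]] := hahn_banach p e sp.
have fle x : f x <= `|x| by exact: le_trans (fp x) (ple x).
have fe1 : f e = 1 by rewrite fe.
have [u [u1 fu] far] := dsd2_far_in_slice f e z delta dsd fle e1 fe1 z1 delta0.
by exists u => //; split=> //; exact: lt_le_trans (fp u).
Qed.

(** * Absolute norms on the plane *)

(** For [a <= b], compare [(a, b)] with [(b, b) = (a, b) + (b - a, 0)], whose norm
is [2 b]. *)
Lemma abs_norm11_l1 {R : realType} (N : absNormalizedNorm R) (a b : R) :
  N (1, 1) = 2 -> 0 <= a -> 0 <= b -> N (a, b) = a + b.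
Proof.
move=> N2; wlog: N N2 a b / a <= b => [hwlog|ab] a0 b0.
  have [|/ltW ba] := leP a b; first by move=> ?; exact: hwlog.
  by rewrite addrC; exact: (hwlog (abs_norm_swap N)).
have Ndiag : N (b, b) = b * 2.
  by have := abs_norm_scale N b 1 1; rewrite mulr1 N2 ger0_norm.
apply/le_anti/andP; split.
  have := abs_norm_triangle N (a, 0) (0, b).
  rewrite abs_norm_x0 abs_norm_0x !ger0_norm//.
  by have -> : (a, 0) + (0, b) = (a, b) :> R * R by congr pair; rewrite /= ?addr0 ?add0r.
have := abs_norm_triangle N (a, b) (b - a, 0).
have -> : (a, b) + (b - a, 0) = (b, b) :> R * R.
  by congr pair; rewrite /= ?addr0// addrC subrK.
rewrite abs_norm_x0 Ndiag ger0_norm ?subr_ge0//; lra.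
Qed.

Lemma abs_norm11_linfty {R : realType} (N : absNormalizedNorm R) (a b : R) :
  N (1, 1) = 1 -> 0 <= a -> 0 <= b -> N (a, b) = Num.max a b.
Proof.
move=> N1; wlog: N N1 a b / a <= b => [hwlog|ab] a0 b0.
  have [|/ltW ba] := leP a b; first by move=> ?; rewrite hwlog// max_r.
  have := hwlog (abs_norm_swap N) N1 b a ba b0 a0.
  by rewrite max_r.
have Ndiag : N (b, b) = b.
  by have := abs_norm_scale N b 1 1; rewrite mulr1 N1 mulr1 ger0_norm.
rewrite max_r//; apply/le_anti/andP; split.
  by rewrite -[leRHS]Ndiag abs_norm_le.
by rewrite -[leLHS](ger0_norm b0) -(abs_norm_0x N) abs_norm_le.
Qed.

(** Moving the first coordinate from [a] to 1 costs at most [1 - a < eps] and, by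
monotonicity, cannot decrease the norm. *)
Lemma abs_norm_near_face {R : realType} (N : absNormalizedNorm R) (a b eps : R) :
  0 <= a -> 0 <= b -> N (a, b) <= 1 -> 1 - eps < a -> 2 - eps < N (a, 1 + b) ->
  [/\ 0 <= b, b <= 1, N (1, b) <= 1 + eps & 2 - eps <= N (1, 1 + b)].
Proof.
move=> a0 b0 Nab a_near far.
have a1 : a <= 1.
  rewrite -(ger0_norm a0) -(abs_norm_x0 N); apply: le_trans Nab.
  by apply: abs_norm_le.
split=> //.
- rewrite -(ger0_norm b0) -(abs_norm_0x N); apply: le_trans Nab.
  by apply: abs_norm_le.
- have -> : (1, b) = (a, b) + (1 - a, 0) :> R * R.
    by congr pair; rewrite /= ?addr0// addrC subrK.
  rewrite (le_trans (abs_norm_triangle _ _ _))// abs_norm_x0 ger0_norm; last lra.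
  lra.
- by rewrite (le_trans (ltW far))//; apply: abs_norm_le => //; rewrite addr_ge0.
Qed.

(** * The norm of an absolute sum *)

(** Up to [eps], each of the next two lemmas says that the unit sphere of [N]
contains the segment from one unit coordinate vector to a point of the face
where the other coordinate is 1. *)
Section daugavet_absolute_sum.
Context {R : realType} (N : absNormalizedNorm R) {X Y : normedModType R}.
Variables (x : X) (y : Y).
Hypotheses (dsd : diametral_strong_diameter2 (abs_sum N X Y))
  (x1 : `|x| = 1) (y1 : `|y| = 1).

Let normX : `|abs_pair N x (0 : Y)| = 1.
Proof. by rewrite abs_sum_normE normr0 x1 abs_norm10. Qed.

Let normY : `|abs_pair N (0 : X) y| = 1.
Proof. by rewrite abs_sum_normE normr0 y1 abs_norm01. Qed.

Lemma dsd2_abs_norm_l eps : 0 < eps ->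
  exists q, [/\ 0 <= q, q <= 1, N (1, q) <= 1 + eps & 2 - eps <= N (1, 1 + q)].
Proof.
move=> eps0; pose p (z : abs_sum N X Y) : R := `|z.1|.
have sp : sublinear p.
  split=> [z w|t z t0]; first exact: ler_normD.
  by rewrite /p /= normrZ ger0_norm.
have [u [u1 pu] far] := dsd2_far_in_face p _ _ eps dsd sp
  (@abs_sum_norm_ge1 R N X Y) normX x1 normY eps0.
exists `|u.2|; apply: (abs_norm_near_face N (`|u.1|)) => //.
apply: lt_le_trans far _; apply: abs_norm_le => //; first by rewrite /= subr0.
apply: le_trans (ler_normB (u.2) y) _.
by rewrite y1 addrC.
Qed.

Lemma dsd2_abs_norm_r eps : 0 < eps ->
  exists p, [/\ 0 <= p, p <= 1, N (p, 1) <= 1 + eps & 2 - eps <= N (1 + p, 1)].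
Proof.
move=> eps0; pose p (z : abs_sum N X Y) : R := `|z.2|.
have sp : sublinear p.
  split=> [z w|t z t0]; first exact: ler_normD.
  by rewrite /p /= normrZ ger0_norm.
have [u [u1 pu] far] := dsd2_far_in_face p _ _ eps dsd sp
  (@abs_sum_norm_ge2 R N X Y) normY y1 normX eps0.
exists `|u.1|; apply: (abs_norm_near_face (abs_norm_swap N) (`|u.2|)) => //.
apply: lt_le_trans far _; apply: abs_norm_le => //; last by rewrite /= subr0.
apply: le_trans (ler_normB (u.1) x) _.
by rewrite x1 addrC.
Qed.

End daugavet_absolute_sum.

(** With [K = N (1, 1)] and all errors dropped: [p] and [q] are at least [2 - K], so
[(3 - K) K] is at most [N (1 + p, 1 + q) <= N (p, 1) + N (1, q) = 2]. *)
Lemma abs_norm11_dichotomy {R : realType} (N : absNormalizedNorm R) :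
  (forall eps, 0 < eps -> exists q,
    [/\ 0 <= q, q <= 1, N (1, q) <= 1 + eps & 2 - eps <= N (1, 1 + q)]) ->
  (forall eps, 0 < eps -> exists p,
    [/\ 0 <= p, p <= 1, N (p, 1) <= 1 + eps & 2 - eps <= N (1 + p, 1)]) ->
  N (1, 1) = 2 \/ N (1, 1) = 1.
Proof.
move=> Nl Nr; set K := N (1, 1).
have K1 : 1 <= K by rewrite -(abs_norm10 N) abs_norm_le.
have K2 : K <= 2.
  have := abs_norm_triangle N (1, 0) (0, 1).
  rewrite abs_norm10 abs_norm01.
  have -> // : (1, 0) + (0, 1) = (1, 1) :> R * R.
  by congr pair; rewrite /= ?addr0 ?add0r.
suff : (3 - K) * K <= 2.
  move=> h; have /eqP : (K - 2) * (K - 1) = 0 by nra.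
  by rewrite mulf_eq0 !subr_eq0 => /orP[/eqP|/eqP]; [left|right].
apply/ler_addgt0Pr => e e0; have e4 : 0 < e / 4 by rewrite divr_gt0.
have [q [q0 q1 N1q N1q1]] := Nl _ e4; have [p [p0 p1 Np1 Np11]] := Nr _ e4.
have Kq : 2 - e / 4 - q <= K.
  have := abs_norm_triangle N (1, 1) (0, q); rewrite abs_norm_0x ger0_norm//.
  have -> : (1, 1) + (0, q) = (1, 1 + q) :> R * R by congr pair; rewrite /= ?addr0.
  by rewrite -/K; lra.
have Kp : 2 - e / 4 - p <= K.
  have := abs_norm_triangle N (1, 1) (p, 0); rewrite abs_norm_x0 ger0_norm//.
  have -> : (1, 1) + (p, 0) = (1 + p, 1) :> R * R by congr pair; rewrite /= ?addr0.
  by rewrite -/K; lra.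
pose m := Num.min p q.
have [m0 mp mq Km] : [/\ 0 <= m, m <= p, m <= q & 2 - e / 4 - m <= K].
  by rewrite /m; case: (leP p q) => pq; split=> //; exact: ltW.
have mK : (1 + m) * K <= 2 + e / 2.
  have := abs_norm_scale N (1 + m) 1 1; rewrite mulr1 ger0_norm; last lra.
  move=> <-; have := abs_norm_triangle N (p, 1) (1, q).
  have -> : (p, 1) + (1, q) = (p + 1, 1 + q) :> R * R by [].
  have : N (1 + m, 1 + m) <= N (p + 1, 1 + q) by apply: abs_norm_le; lra.
  by lra.
by nra.
Qed.

Lemma exists_norm1 {R : realType} {V : normedModType R} (x : V) :
  x != 0 -> exists e : V, `|e| = 1.
Proof.
move=> x0; exists (`|x|^-1 *: x).
by rewrite normrZ normfV normr_id mulVf// normr_eq0.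
Qed.

Theorem corollary3p8 (R : realType) (X Y : completeNormedModType R)
  (N : absNormalizedNorm R) :
  diametral_strong_diameter2 (abs_sum N X Y) ->
  (forall (x : X) (y : Y), `|abs_pair N x y| = `|abs_pair (l1_norm R) x y|) \/
  (forall (x : X) (y : Y),
     `|abs_pair N x y| = `|abs_pair (linfty_norm R) x y|).
Proof.
move=> dsd.
have [X0|/existsNP[x /eqP/exists_norm1[x1 x1E]]] := pselect (forall x : X, x = 0).
  right=> x y; rewrite !abs_sum_normE (X0 x) normr0.
  by rewrite !abs_norm_0x.
have [Y0|/existsNP[y /eqP/exists_norm1[y1 y1E]]] := pselect (forall y : Y, y = 0).
  right=> x' y; rewrite !abs_sum_normE (Y0 y) normr0.
  by rewrite !abs_norm_x0.
have [| |N11|N11] := abs_norm11_dichotomy N.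
- by move=> eps; exact: (dsd2_abs_norm_l N x1 y1).
- by move=> eps; exact: (dsd2_abs_norm_r N x1 y1).
- by left=> x' y'; rewrite !abs_sum_normE abs_norm11_l1//= !normr_id.
- by right=> x' y'; rewrite !abs_sum_normE abs_norm11_linfty//= !normr_id.
Qed.
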